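(* Let $\alpha,\beta>0$, $\gamma\in\mathbb{R}$ and let $n\ge 1$ be an integer. For $t<0$ let $D_n(t)$ be the Hankel determinant of the generalized Jacobi weight $w(x;t)=(x-t)^{\gamma}x^{\alpha}(1-x)^{\beta}$ on $[0,1]$, and define $$H_n(t):=t(t-1)\frac{d}{dt}\ln D_n(t),\qquad \widetilde H_n(t):=H_n(t)+d_1t+d_2,$$ where $$d_1=-n(n+\alpha+\beta+\gamma)-\frac{(\alpha+\beta)^2}{4},\qquad d_2=\frac14\Bigl[2n(n+\alpha+\beta+\gamma)+\beta(\alpha+\beta)-\gamma(\alpha-\beta)\Bigr].$$ Then, for $t<0$, $\widetilde H_n$ satisfies the Jimbo-Miwa-Okamoto $\sigma$-form of Painlev\'e VI $$\widetilde H_n'\bigl(t(t-1)\widetilde H_n''\bigr)^2+\Bigl\{2\widetilde H_n'\bigl(t\widetilde H_n'-\widetilde H_n\bigr)-(\widetilde H_n')^2-\nu_1\nu_2\nu_3\nu_4\Bigr\}^2=(\widetilde H_n'+\nu_1^2)(\widetilde H_n'+\nu_2^2)(\widetilde H_n'+\nu_3^2)(\widetilde H_n'+\nu_4^2),$$ with $$\nu_1=\frac{\alpha+\beta}{2},\quad \nu_2=\frac{\beta-\alpha}{2},\quad \nu_3=\frac{2n+\alpha+\beta}{2},\quad \nu_4=\frac{2n+\alpha+\beta+2\gamma}{2}.$$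
   Context: The Hankel determinant is $$D_n(t)=\det\left(\int_0^1 x^{j+k}w(x;t)\,dx\right)_{j,k=0}^{n-1}=\frac1{n!}\int_0^1\cdots\int_0^1\prod_{i<j}(x_i-x_j)^2\prod_{k=1}^n w(x_k;t)\,dx_k,$$ which is positive for $t<0$. Primes denote derivatives with respect to $t$. *)

(* Defs.v *)
From HB Require Import structures.
From mathcomp Require Export all_boot all_order all_algebra.
From mathcomp Require Export all_classical all_reals all_analysis.

Set Implicit Arguments.
Unset Strict Implicit.
Unset Printing Implicit Defensive.

Export Order.TTheory GRing.Theory Num.Theory numFieldNormedType.Exports.

Global Open Scope ring_scope.

Definition jacobi_weight (R : realType) (alpha beta gamma x t : R) : R :=
  (x - t) `^ gamma * x `^ alpha * (1 - x) `^ beta.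

Definition hankel_det (R : realType) (n : nat) (alpha beta gamma t : R) : R :=
  \det (\matrix_(j < n, k < n)
          \int[lebesgue_measure]_(x in `[0, 1]%classic)
             (x ^+ (j + k) * jacobi_weight alpha beta gamma x t)).

(* [ln] and [derive1] are total functions in the library; only [t < 0], where
   the determinant is positive, is relevant. *)
Definition Hn (R : realType) (n : nat) (alpha beta gamma t : R) : R :=
  t * (t - 1) * derive1 (fun s : R => ln (hankel_det n alpha beta gamma s)) t.

Definition d1 (R : realType) (n : nat) (alpha beta gamma : R) : R :=
  - (n%:R * (n%:R + alpha + beta + gamma)) - (alpha + beta) ^+ 2 / 4.

Definition d2 (R : realType) (n : nat) (alpha beta gamma : R) : R :=
  1 / 4 * (2 * n%:R * (n%:R + alpha + beta + gamma)
           + beta * (alpha + beta) - gamma * (alpha - beta)).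

Definition tHn (R : realType) (n : nat) (alpha beta gamma t : R) : R :=
  Hn n alpha beta gamma t + d1 n alpha beta gamma * t + d2 n alpha beta gamma.

Definition Jimbo_Miwa_Okamoto_PVI (R : realType) (nu1 nu2 nu3 nu4 : R) (f : R -> R)
    (t : R) : Prop :=
  let f' := derive1 f in
  let f'' := derive1 f' in
  f' t * (t * (t - 1) * f'' t) ^+ 2
  + (2 * f' t * (t * f' t - f t) - f' t ^+ 2 - nu1 * nu2 * nu3 * nu4) ^+ 2
  = (f' t + nu1 ^+ 2) * (f' t + nu2 ^+ 2)
    * (f' t + nu3 ^+ 2) * (f' t + nu4 ^+ 2).

(* Main.v *)
Require Import Defs.
From HB Require Import structures.
From mathcomp Require Import ring lra.

Set Implicit Arguments.
Unset Strict Implicit.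
Unset Printing Implicit Defensive.

(** The sigma form expresses the isomonodromic deformation of a 2 x 2 Fuchsian
    system with singular points 0, 1, t, and it is obtained here with orthogonal
    polynomials only.

    Let [L] be integration against the weight [w], with [w'/w] equal to
    [alpha / x + beta / (x - 1) + gamma / (x - t)].  The functionals
    [Z], [E], [V], equal to [alpha L(p / x)], [beta L(p / (x - 1))] and
    [gamma L(p / (x - t))], satisfy [Z(p) + E(p) + V(p) = - L(p')] (integration
    by parts), and the derivative of [L(p)] in [t] is [- V(p)].  Let [P] be the
    monic orthogonal polynomial of degree [n] and [q] the one of degree [n - 1]
    divided by its squared norm.  For each functional, the values on [P q],
    [P^2], [q^2] are the entries of a residue matrix.  Three facts hold.

    - The residues are singular ([rank_one]), as one sees by evaluating [P] and
      [q] at the singular point; their sum is diagonal ([residue_sum_Pq],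
      [residue_sum_PP], [residue_sum_qq]).
    - They evolve by the Schlesinger equations ([schlesinger]): with
      [u = E(P^2) V(q^2)] and [w = V(P^2) E(q^2)], the derivative of [E(P q)] is
      [(u - w) / (1 - t)].
    - The subleading coefficient [S] of [P] is [E(P q) + t V(P q)]
      ([subleading_coef]), and its derivative is [V(P q)].

    The determinant is the product of the squared norms of the orthogonal
    polynomials, and the logarithmic derivatives of these norms telescope
    ([log_deriv_step]), so that [H_n] is affine in [S] and [t]
    ([ln_hankel_derive]).  Hence [H_n'] is affine in [V(P q)], and
    [t (t - 1) H_n''] is a constant times [u - w].  Singularity of the residues at
    1 and [t] gives [u w], and singularity at 0 gives [u + w], as polynomials in
    [E(P q)] and [V(P q)]; the sigma form is
    [(u - w)^2 = (u + w)^2 - 4 u w] in these variables ([pvi_id]). *)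

(** * Moment functionals on polynomials *)

(** The linear functional on polynomials with moment sequence [m]. *)
Definition mom (R : nzRingType) (m : nat -> R) (p : {poly R}) : R :=
  \sum_(i < size p) p`_i * m i.

Section Mom.
Context {R : comNzRingType}.
Implicit Types (m : nat -> R) (p q : {poly R}).

Lemma mom_widen m p n : (size p <= n)%N -> mom m p = \sum_(i < n) p`_i * m i.
Proof.
move=> pn; rewrite /mom (big_ord_widen _ (fun i => p`_i * m i) pn) big_mkcond.
apply: eq_bigr => i _; case: ltnP => // /(nth_default 0) ->.
by rewrite mul0r.
Qed.

Lemma mom_is_linear m : linear_for *%R (mom m).
Proof.
move=> k p q; pose n := maxn (size p) (size q).
have pn : (size p <= n)%N by rewrite leq_maxl.
have qn : (size q <= n)%N by rewrite leq_maxr.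
have kpqn : (size (k *: p + q)%R <= n)%N.
  rewrite (leq_trans (size_polyD _ _))// geq_max qn andbT.
  by rewrite (leq_trans (size_scale_leq _ _)).
rewrite (mom_widen _ kpqn) (mom_widen _ pn) (mom_widen _ qn).
rewrite mulr_sumr -big_split/=; apply: eq_bigr => i _.
by rewrite coefD coefZ mulrDl mulrA.
Qed.

HB.instance Definition _ m :=
  GRing.isLinear.Build R {poly R} R *%R (mom m) (mom_is_linear m).

Lemma momD m p q : mom m (p + q) = mom m p + mom m q.
Proof. exact: raddfD. Qed.

Lemma momB m p q : mom m (p - q) = mom m p - mom m q.
Proof. exact: raddfB. Qed.

Lemma momZ m k p : mom m (k *: p) = k * mom m p.
Proof. exact: linearZ. Qed.

Lemma momXn m k : mom m 'X^k = m k.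
Proof.
rewrite (@mom_widen _ _ k.+1) ?size_polyXn// (bigD1 ord_max)//=.
rewrite coefXn eqxx mul1r big1 ?addr0// => i.
by rewrite -val_eqE/= coefXn => /negbTE ->; rewrite mul0r.
Qed.

(** Reads the Pearson equation of a weight, stated for all polynomials, as a
    recurrence between moments. *)
Lemma mom_pearsonXn m m' (a b c : R) k :
  mom m (deriv ('X * (1 - 'X) * 'X^k) + (a *: (1 - 'X) - b *: 'X) * 'X^k)
  + mom m' (c *: ('X * (1 - 'X) * 'X^k)) =
  k.+1%:R * m k - k.+2%:R * m k.+1 + a * (m k - m k.+1) - b * m k.+1
  + c * (m' k.+1 - m' k.+2).
Proof.
have -> : 'X * (1 - 'X) * 'X^k = 'X^(k.+1) - 'X^(k.+2) :> {poly R}.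
  by rewrite !exprS; ring.
have -> : deriv ('X^(k.+1) - 'X^(k.+2)) =
    k.+1%:R *: 'X^k - k.+2%:R *: 'X^(k.+1) :> {poly R}.
  by rewrite derivB !derivXn/= !scaler_nat.
have -> : (a *: (1 - 'X) - b *: 'X) * 'X^k =
    a *: ('X^k - 'X^(k.+1)) - b *: 'X^(k.+1) :> {poly R}.
  by rewrite exprS -!mul_polyC; ring.
by rewrite momD !momB !momZ !momB !momXn addrA.
Qed.

End Mom.

Lemma poly_span_ind (R : nzRingType) (K : {poly R} -> Prop) :
  (forall p q, K p -> K q -> K (p + q)) -> (forall c k, K (c *: 'X^k)) ->
  forall p, K p.
Proof.
move=> KD KX p; rewrite -[p]coefK poly_def; apply: (big_ind K) => //.
by rewrite -(scale0r 'X^0).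
Qed.

(** Lets [ring] deduce an equation from one with the same difference of sides. *)
Lemma eq_by_sub (R : nzRingType) (x y x' y' : R) :
  x' = y' -> x - y = x' - y' -> x = y.
Proof. by move=> -> /eqP; rewrite subrr subr_eq0 => /eqP. Qed.

Section Functionals.
Context {F : fieldType}.
Implicit Types (m s z e v : nat -> F) (p q r : {poly F}).

(** The recurrence on [s] is the moment form of [s = theta m / (x - a)]: this is
    how the functional [p |-> theta L(p / (x - a))] is represented, without any
    division. *)
Lemma mom_shift m s a theta p : (forall k, s k.+1 = a * s k + theta * m k) ->
  mom s (('X - a%:P) * p) = theta * mom m p.
Proof.
move=> sS; elim/poly_span_ind: p => [p q IHp IHq|c k].
  by rewrite mulrDr !momD IHp IHq mulrDr.
have -> : ('X - a%:P) * (c *: 'X^k) = c *: ('X^(k.+1) - a *: 'X^k).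
  by rewrite exprS -!mul_polyC; ring.
by rewrite !momZ momB momZ !momXn sS; ring.
Qed.

(** Integration by parts: the logarithmic derivative of the weight is the sum of
    its three simple fractions. *)
Lemma mom_sum_deriv m z e v p :
  (forall k, z k + e k + v k = - (k%:R * m k.-1)) ->
  mom z p + mom e p + mom v p = - mom m p^`().
Proof.
move=> zev; elim/poly_span_ind: p => [p q IHp IHq|c k].
  by rewrite derivD !momD opprD -IHp -IHq; ring.
by rewrite derivZ derivXn -scaler_nat !momZ !momXn -mulrN -zev; ring.
Qed.

Lemma poly_div_point (a : F) p n : (size p <= n.+2)%N ->
  exists r, [/\ p = p.[a]%:P + ('X - a%:P) * r, (size r <= n.+1)%N
              & r`_n = p`_n.+1].
Proof.
move=> sp; have /factor_theorem[r Er] : root (p - p.[a]%:P) a.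
  by rewrite rootE !hornerE subrr.
have Ep : p = p.[a]%:P + ('X - a%:P) * r by rewrite mulrC -Er; ring.
have sr : (size r <= n.+1)%N.
  have [->|r0] := eqVneq r 0; first by rewrite size_poly0.
  have := size_XsubC a => sX.
  have : size (p - p.[a]%:P) = (size r).+1.
    by rewrite Er size_Mmonic ?monicXsubC// sX addn2.
  move=> E; rewrite -ltnS -E (leq_trans (size_polyD _ _))// geq_max sp size_polyN.
  by rewrite (leq_trans (size_polyC_leq1 _)).
exists r; split => //.
rewrite Ep coefD coefC/= mulrBl coefB coefXM/= coefCM (nth_default 0 sr).
by rewrite mulr0 subr0 add0r.
Qed.

Lemma poly_split_monic p P n : P \is monic -> size P = n.+1 ->
  (size p <= n.+1)%N ->
  exists2 r : {poly F}, (size r <= n)%N & p = p`_n *: P + r.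
Proof.
move=> /monicP Pm sP sp; exists (p - p`_n *: P); last by rewrite addrC subrK.
apply/leq_sizeP => j; rewrite leq_eqVlt => /predU1P[<-|nj].
  have : P`_n = 1 by rewrite -[RHS]Pm lead_coefE sP.
  by rewrite coefB coefZ => ->; rewrite mulr1 subrr.
have Pj : (size P <= j)%N by rewrite sP.
rewrite coefB coefZ (nth_default 0 (leq_trans sp nj)) (nth_default 0 Pj).
by rewrite mulr0 subrr.
Qed.

End Functionals.

(** * The pair (P, q) and its residue matrices *)

(** [P] is the monic orthogonal polynomial of degree [N + 1], and [q] the one of
    degree [N] divided by its squared norm, so that pairing with [q] extracts the
    coefficient of degree [N].  For a singular point [a] of the weight, with
    functional [s], the numbers [s(P q)], [s(P^2)], [s(q^2)] are up to sign the
    entries of the residue at [a] of the linear system satisfied by [P, q]. *)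
Section DualPair.
Context {F : fieldType}.
Variables (m : nat -> F) (N : nat) (P q : {poly F}).
Local Notation L := (mom m).
Hypothesis L_def : forall p : {poly F}, p != 0 -> L (p * p) != 0.
Hypothesis P_monic : P \is monic.
Hypothesis P_size : size P = N.+2.
Hypothesis q_size : (size q <= N.+1)%N.
Hypothesis P_orth : forall p : {poly F}, (size p <= N.+1)%N -> L (P * p) = 0.
Hypothesis q_dual : forall p : {poly F}, (size p <= N.+1)%N -> L (q * p) = p`_N.

Let P_lead : P`_N.+1 = 1.
Proof. by have /monicP := P_monic; rewrite lead_coefE P_size. Qed.

(** The residue matrix at [a] is singular.  Writing [p = p(a) + (x - a) r] gives
    [s(f p) = p(a) s(f) + theta L(f r)], and orthogonality kills every second
    term except for [f = q], [p = P], where it equals [theta]. *)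
Lemma rank_one s a theta : (forall k, s k.+1 = a * s k + theta * m k) ->
  mom s (P * P) * mom s (q * q) = mom s (P * q) * (mom s (P * q) - theta).
Proof.
move=> sS.
have E (f p r : {poly F}) : p = p.[a]%:P + ('X - a%:P) * r ->
    mom s (f * p) = p.[a] * mom s f + theta * L (f * r).
  move=> Ep; rewrite {1}Ep.
  have -> : f * (p.[a]%:P + ('X - a%:P) * r) =
      p.[a] *: f + ('X - a%:P) * (f * r) by rewrite -mul_polyC; ring.
  by rewrite momD momZ (mom_shift _ sS).
have [P1 [EP sP1 cP1]] := @poly_div_point _ a P N (eq_leq P_size).
have [q1 [Eq sq1 cq1]] := @poly_div_point _ a q N (leqW q_size).
rewrite (E P P P1 EP) (E q q q1 Eq) (E P q q1 Eq) P_orth// P_orth// q_dual//.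
rewrite cq1 (nth_default 0 q_size).
have : mom s (q * P) = P.[a] * mom s q + theta.
  by rewrite (E q P P1 EP) q_dual// cP1 P_lead mulr1.
rewrite mulrC (E P q q1 Eq) P_orth// => H; ring: H.
Qed.

(** [L] is definite, and [P] completes the polynomials of lower degree to a
    basis. *)
Lemma poly_determined (E : {poly F}) : (size E <= N.+2)%N ->
  (forall p : {poly F}, (size p <= N.+1)%N -> L (E * p) = 0) -> L (E * P) = 0 -> E = 0.
Proof.
move=> sE E0 EP0; apply/eqP/negPn/negP => /L_def /negP; apply; apply/eqP.
have [r sr Er] := poly_split_monic P_monic P_size sE.
rewrite {2}Er mulrDr momD (E0 r sr) addr0.
by rewrite -scalerAr momZ EP0 mulr0.
Qed.

Variables (v : nat -> F) (t gamma : F).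
Local Notation V := (mom v).
Hypothesis v_shift : forall k, v k.+1 = t * v k + gamma * m k.

(** The equation in [t] of the linear system, for [f = P] ([eps = 0]) and [f = q]
    ([eps = 1]) at once.  A variation [df] is determined by its pairings, which
    come from differentiating those of [f]; multiplication by [x - t] turns the
    functional [V] back into [gamma L], so both sides pair equally with every
    polynomial of degree at most [N] and with [P]. *)
Lemma deform_pair (f df : {poly F}) eps : (size df <= N.+1)%N ->
  (forall p : {poly F}, (size p <= N.+1)%N -> L (f * p) = eps * p`_N) ->
  (forall p : {poly F}, (size p <= N.+1)%N -> L (df * p) = V (f * p)) ->
  ('X - t%:P) * df = V (f * q) *: P + (gamma * eps - V (f * P)) *: q.
Proof.
move=> sdf fL dfL.
have sX (r : {poly F}) : (size r <= N.+1)%N -> (size (('X - t%:P) * r)%R <= N.+2)%N.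
  by move=> sr; rewrite (leq_trans (size_polyMleq _ _))// size_XsubC.
have cX (r : {poly F}) : (size r <= N.+1)%N -> (('X - t%:P) * r)`_N.+1 = r`_N.
  by move=> sr; rewrite mulrBl coefB coefXM coefCM/= (nth_default 0 sr) mulr0 subr0.
have dfP : L (df * P) = 0 by rewrite mulrC P_orth.
apply/eqP; rewrite -subr_eq0; apply/eqP; apply: poly_determined.
- rewrite (leq_trans (size_polyD _ _))// geq_max sX//= size_polyN.
  rewrite (leq_trans (size_polyD _ _))// geq_max.
  by rewrite !(leq_trans (size_scale_leq _ _))// ?P_size// (leq_trans q_size).
- move=> r sr.
  have [r2 sr2 Er] := poly_split_monic P_monic P_size (sX r sr).
  rewrite cX// in Er.
  rewrite [_ * r]mulrBl momB [(_ + _) * r]mulrDl momD -!scalerAl !momZ.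
  rewrite P_orth// q_dual// mulr0 add0r.
  have -> : ('X - t%:P) * df * r = df * (('X - t%:P) * r) by ring.
  rewrite Er mulrDr momD -scalerAr momZ dfP mulr0 add0r dfL//.
  have -> : f * r2 = ('X - t%:P) * (f * r) - r`_N *: (f * P).
    have -> : r2 = ('X - t%:P) * r - r`_N *: P by rewrite Er addrC addKr.
    by rewrite -!mul_polyC; ring.
  by rewrite momB momZ (mom_shift _ v_shift) fL//; ring.
- have [r2 sr2 Er] := poly_split_monic P_monic P_size (sX df sdf).
  rewrite cX// in Er.
  rewrite [_ * P]mulrBl momB [(_ + _) * P]mulrDl momD -!scalerAl !momZ.
  rewrite [q * P]mulrC (P_orth q_size) mulr0 addr0.
  rewrite Er mulrDl momD -scalerAl momZ [r2 * P]mulrC (P_orth sr2) addr0.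
  have -> : V (f * q) = df`_N by rewrite -dfL// mulrC q_dual.
  by rewrite subrr.
Qed.

Lemma P_neq0 : P != 0.
Proof. exact: monic_neq0. Qed.

Lemma deriv_P_size : (size (deriv P) <= N.+1)%N.
Proof. by rewrite -ltnS -P_size lt_size_deriv ?P_neq0. Qed.

Lemma deriv_q_size : (size (deriv q) <= N.+1)%N.
Proof.
have [->|q0] := eqVneq q 0; first by rewrite deriv0 size_poly0.
by rewrite ltnW// (leq_trans (lt_size_deriv q0)).
Qed.

Lemma dual_deriv_P : L (q * deriv P) = N.+1%:R.
Proof. by rewrite q_dual ?deriv_P_size// coef_deriv P_lead. Qed.

Lemma dual_deriv_q : L (q * deriv q) = 0.
Proof.
by rewrite q_dual ?deriv_q_size// coef_deriv (nth_default 0 q_size) mul0rn.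
Qed.

(** [x P' - (N + 1) P] has degree at most [N], with coefficient [- P`_N]
    there. *)
Lemma dual_mulX_deriv_P : L (q * ('X * deriv P)) = - P`_N.
Proof.
have cXd k : ('X * deriv P)`_k = P`_k *+ k.
  by case: k => [|k]; rewrite coefXM/= ?mulr0n// coef_deriv.
have sXd : (size ('X * deriv P)%R <= N.+2)%N.
  rewrite (leq_trans (size_polyMleq _ _))// size_polyX/=.
  by rewrite ltnS deriv_P_size.
have [r sr Er] := poly_split_monic P_monic P_size sXd.
have cr : r`_N = - P`_N.
  have := cXd N; rewrite Er coefD coefZ cXd P_lead -(mulr_natl _ N).
  by rewrite -natr1 => H; apply: (eq_by_sub H); ring.
rewrite Er mulrDr momD -scalerAr momZ (mulrC q) (P_orth q_size) mulr0 add0r.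
by rewrite q_dual.
Qed.

Section Residues.
Variables (z e : nat -> F) (alpha beta : F).
Local Notation Z := (mom z).
Local Notation E := (mom e).
Hypothesis z_shift : forall k, z k.+1 = 0 * z k + alpha * m k.
Hypothesis e_shift : forall k, e k.+1 = 1 * e k + beta * m k.
Hypothesis residue_sum : forall k, z k + e k + v k = - (k%:R * m k.-1).

(** The three residues add up to a diagonal matrix: this is the residue at
    infinity of the linear system. *)
Lemma residue_sum_Pq : Z (P * q) + E (P * q) + V (P * q) = - N.+1%:R.
Proof.
rewrite (mom_sum_deriv _ residue_sum) derivM momD (P_orth deriv_q_size).
by rewrite addr0 mulrC dual_deriv_P.
Qed.

Lemma residue_sum_PP : Z (P * P) + E (P * P) + V (P * P) = 0.
Proof.
rewrite (mom_sum_deriv _ residue_sum) derivM momD (P_orth deriv_P_size).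
by rewrite addr0 mulrC (P_orth deriv_P_size) oppr0.
Qed.

Lemma residue_sum_qq : Z (q * q) + E (q * q) + V (q * q) = 0.
Proof.
rewrite (mom_sum_deriv _ residue_sum) derivM momD dual_deriv_q.
by rewrite addr0 mulrC dual_deriv_q oppr0.
Qed.

(** First moment of the residues: integration by parts of [x P q]. *)
Lemma subleading_coef : P`_N = E (P * q) + t * V (P * q).
Proof.
have := mom_sum_deriv ('X * (P * q)) residue_sum.
have LPq : L (P * q) = 0 by exact: P_orth.
have -> : Z ('X * (P * q)) = 0.
  have -> : 'X = 'X - 0%:P :> {poly F} by rewrite subr0.
  by rewrite (mom_shift _ z_shift) LPq mulr0.
have -> : E ('X * (P * q)) = E (P * q).
  have -> : 'X * (P * q) = ('X - 1%:P) * (P * q) + P * q.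
    by rewrite polyC1; ring.
  by rewrite momD (mom_shift _ e_shift) LPq mulr0 add0r.
have -> : V ('X * (P * q)) = t * V (P * q).
  have -> : 'X * (P * q) = ('X - t%:P) * (P * q) + t *: (P * q).
    by rewrite -mul_polyC; ring.
  by rewrite momD momZ (mom_shift _ v_shift) LPq mulr0 add0r.
have -> : deriv ('X * (P * q)) =
    P * q + q * ('X * deriv P) + P * ('X * deriv q).
  by rewrite !derivM derivX; ring.
have sXq : (size ('X * deriv q)%R <= N.+1)%N.
  have [->|q0] := eqVneq q 0; first by rewrite deriv0 mulr0 size_poly0.
  rewrite (leq_trans (size_polyMleq _ _))// size_polyX/=.
  by rewrite (leq_trans (lt_size_deriv q0)).
rewrite !momD LPq dual_mulX_deriv_P (P_orth sXq) => /esym H.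
by apply: (eq_by_sub H); ring.
Qed.

Variables (dP dq : {poly F}).
Hypothesis dP_size : (size dP <= N.+1)%N.
Hypothesis dq_size : (size dq <= N.+1)%N.
Hypothesis dP_orth : forall p : {poly F}, (size p <= N.+1)%N -> L (dP * p) = V (P * p).
Hypothesis dq_dual : forall p : {poly F}, (size p <= N.+1)%N -> L (dq * p) = V (q * p).

(** The diagonal entry of the Schlesinger equation
    [dA_1/dt = [A_t, A_1] / (t - 1)].  [de] stands for the variation of the
    functional [E] on [P q]; the other two terms are computed from
    [deform_pair], since [(1 - t) E(p) = E((x - t) p) - beta L(p)]. *)
Lemma schlesinger de : (1 - t) * de = beta * V (P * q) - gamma * E (P * q) ->
  (1 - t) * (de + E (dP * q) + E (P * dq)) =
  E (P * P) * V (q * q) - V (P * P) * E (q * q).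
Proof.
move=> Hde.
have HP : ('X - t%:P) * dP = V (P * q) *: P - V (P * P) *: q.
  rewrite (@deform_pair P dP 0)// ?mulr0 ?sub0r ?scaleNr// => p sp.
  by rewrite P_orth// mul0r.
have Hq : ('X - t%:P) * dq = V (q * q) *: P + (gamma - V (P * q)) *: q.
  rewrite (@deform_pair q dq 1)// ?mulr1 ?[P * q]mulrC// => p sp.
  by rewrite q_dual// mul1r.
have Et p : (1 - t) * E p = E (('X - t%:P) * p) - beta * L p.
  rewrite -(mom_shift _ e_shift) -momB -momZ; congr E.
  by rewrite -mul_polyC polyCB; ring.
rewrite 2!mulrDr Hde !Et.
have -> : ('X - t%:P) * (dP * q) = V (P * q) *: (P * q) - V (P * P) *: (q * q).
  by rewrite mulrA HP -!mul_polyC; ring.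
have -> : ('X - t%:P) * (P * dq) =
    V (q * q) *: (P * P) + (gamma - V (P * q)) *: (P * q).
  by rewrite mulrCA Hq -!mul_polyC; ring.
by rewrite momB momD !momZ dP_orth// P_orth//; ring.
Qed.

End Residues.
End DualPair.

(** * The logarithmic derivative of a norm *)

Section LogDerivative.
Context {F : fieldType}.
Variables (m z e v : nat -> F) (t alpha beta gamma : F).
Local Notation L := (mom m).
Local Notation V := (mom v).
Hypothesis z_shift : forall k, z k.+1 = 0 * z k + alpha * m k.
Hypothesis e_shift : forall k, e k.+1 = 1 * e k + beta * m k.
Hypothesis v_shift : forall k, v k.+1 = t * v k + gamma * m k.
Hypothesis residue_sum : forall k, z k + e k + v k = - (k%:R * m k.-1).

(** Integrating [x (x - 1) p] by parts removes the singularities at 0 and 1, and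
    [x (x - 1) = (x - t) (x + t - 1) + t (t - 1)] isolates the one at [t]. *)
Lemma residue_t_eliminate p : t * (t - 1) * V p =
  - (gamma * L (('X + (t - 1)%:P) * p) + L (deriv ('X * ('X - 1%:P) * p))
     + alpha * L (('X - 1%:P) * p) + beta * L ('X * p)).
Proof.
have := mom_sum_deriv ('X * ('X - 1%:P) * p) residue_sum.
have -> : mom z ('X * ('X - 1%:P) * p) = alpha * L (('X - 1%:P) * p).
  rewrite -(mom_shift _ z_shift); congr mom; rewrite polyC0 subr0; ring.
have -> : mom e ('X * ('X - 1%:P) * p) = beta * L ('X * p).
  by rewrite -(mom_shift _ e_shift); congr mom; ring.
have -> : V ('X * ('X - 1%:P) * p) =
    gamma * L (('X + (t - 1)%:P) * p) + t * (t - 1) * V p.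
  rewrite -(mom_shift _ v_shift) -momZ -momD; congr mom.
  by rewrite -mul_polyC polyCM polyCB; ring.
by move=> H; apply: (eq_by_sub H); ring.
Qed.

Variables (n : nat) (P P1 : {poly F}).
Hypothesis P_monic : P \is monic.
Hypothesis P_size : size P = n.+1.
Hypothesis P_orth : forall p : {poly F}, (size p <= n)%N -> L (P * p) = 0.
Hypothesis P1_monic : P1 \is monic.
Hypothesis P1_size : size P1 = n.+2.
Hypothesis P1_orth : forall p : {poly F}, (size p <= n.+1)%N -> L (P1 * p) = 0.

Let s := (P * 'X)`_n.
Let s1 := (P1 * 'X)`_n.+1.
Let h := L (P * P).

Lemma orth_lead (p : {poly F}) : (size p <= n.+1)%N -> L (P * p) = p`_n * h.
Proof.
move=> sp; have [r sr Er] := poly_split_monic P_monic P_size sp.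
by rewrite {1}Er mulrDr momD (P_orth sr) addr0 -scalerAr momZ.
Qed.

(** After [residue_t_eliminate], everything is a pairing of [P] with [x P],
    [x P'] and [x^2 P'], hence a multiple of the norm by coefficients of [P] and
    of the next polynomial [P1].  Multiplying by ['X] before taking the
    subleading coefficient gives the value 0 when [n = 0]. *)
Lemma log_deriv_step : t * (t - 1) * V (P * P) =
  - ((gamma + 2 + alpha + beta + 2 * n%:R) * (s - s1) - 2 * s
     + gamma * (t - 1) - 1 - alpha - 2 * n%:R) * h.
Proof.
have Plead : P`_n = 1 by have /monicP := P_monic; rewrite lead_coefE P_size.
have P1lead : P1`_n.+1 = 1 by have /monicP := P1_monic; rewrite lead_coefE P1_size.
have LXPP : L (P * ('X * P)) = (s - s1) * h.
  have sXP : (size ('X * P)%R <= n.+2)%N.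
    by rewrite (leq_trans (size_polyMleq _ _))// size_polyX P_size.
  have [r sr Er] := poly_split_monic P1_monic P1_size sXP.
  have c1 : ('X * P)`_n.+1 = 1 by rewrite coefXM.
  rewrite c1 scale1r in Er.
  have -> : L (P * ('X * P)) = L (P * r).
    by rewrite Er mulrDr momD mulrC P1_orth ?P_size// add0r.
  rewrite orth_lead//; congr (_ * h).
  have -> : r = 'X * P - P1 by rewrite Er addrC addKr.
  by rewrite coefB /s /s1 mulrC !coefMX/=.
have cXd k : ('X * deriv P)`_k = P`_k *+ k.
  by case: k => [|k]; rewrite coefXM/= ?mulr0n// coef_deriv.
have sXd : (size ('X * deriv P)%R <= n.+1)%N.
  rewrite (leq_trans (size_polyMleq _ _))// size_polyX/= -P_size.
  by rewrite lt_size_deriv// monic_neq0.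
have LXdP : L (P * ('X * deriv P)) = n%:R * h.
  by rewrite orth_lead// cXd Plead.
have LXXdP : L (P * ('X * ('X * deriv P))) = n%:R * ((s - s1) * h) - s * h.
  have [r sr Er] := poly_split_monic P_monic P_size sXd.
  rewrite cXd Plead in Er.
  have sXr : (size ('X * r)%R <= n.+1)%N.
    by rewrite (leq_trans (size_polyMleq _ _))// size_polyX.
  have cXr : ('X * r)`_n = - s.
    have -> : r = 'X * deriv P - n%:R *: P by rewrite Er addrC addKr.
    rewrite mulrBr coefB [('X * ('X * _))`_n]coefXM [('X * (_ *: _))`_n]coefXM.
    rewrite /s coefMX; case: (n) => [|k]/=.
      by rewrite subr0 oppr0.
    by rewrite cXd coefZ -(mulr_natl _ k) -natr1; ring.
  have -> : P * ('X * ('X * deriv P)) = n%:R *: (P * ('X * P)) + P * ('X * r).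
    by rewrite Er -!mul_polyC; ring.
  by rewrite momD momZ LXPP orth_lead// cXr mulNr.
rewrite residue_t_eliminate.
have -> : deriv ('X * ('X - 1%:P) * (P * P)) =
   2 *: (P * ('X * P)) + 2 *: (P * ('X * ('X * deriv P)))
   - P * P - 2 *: (P * ('X * deriv P)).
  by rewrite !derivM derivB derivX derivC -!mul_polyC; ring.
have -> : ('X + (t - 1)%:P) * (P * P) = P * ('X * P) + (t - 1) *: (P * P).
  by rewrite -mul_polyC; ring.
have -> : ('X - 1%:P) * (P * P) = P * ('X * P) - P * P by ring.
have -> : 'X * (P * P) = P * ('X * P) by ring.
rewrite !momB !momD !momZ LXPP LXdP LXXdP -/h; ring.
Qed.

End LogDerivative.

(** * Hankel determinants and orthogonal polynomials *)

Definition hankel_mx (R : nzRingType) (m : nat -> R) n : 'M[R]_n :=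
  \matrix_(j < n, k < n) m (j + k)%N.

(** Last column of the adjugate of the next Hankel matrix, divided by the
    determinant: orthogonality is then the product of a matrix with its adjugate,
    and the coefficients are visibly rational in the moments. *)
Definition orth_poly (F : fieldType) (m : nat -> F) n : {poly F} :=
  (\det (hankel_mx m n))^-1 *:
  \poly_(k < n.+1) cofactor (hankel_mx m n.+1) ord_max (inord k).

Section Hankel.
Context {F : fieldType}.
Variable m : nat -> F.
Local Notation L := (mom m).
Local Notation D n := (\det (hankel_mx m n)).
Local Notation P n := (orth_poly m n).
Implicit Types (p q r : {poly F}).

Lemma mom_mulXn p j : L (p * 'X^j) = mom (fun i => m (i + j)%N) p.
Proof.
elim/poly_span_ind: p => [p q IHp IHq|c k].
  by rewrite mulrDl !momD IHp IHq.
by rewrite -scalerAl !momZ -exprD !momXn.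
Qed.

Lemma orth_poly_size_le n : (size (P n) <= n.+1)%N.
Proof. by rewrite (leq_trans (size_scale_leq _ _))// size_poly. Qed.

Lemma hankel_cofactor n : cofactor (hankel_mx m n.+1) ord_max ord_max = D n.
Proof.
rewrite /cofactor -signr_odd oddD addbb mul1r; congr (\det _).
by apply/matrixP => i j; rewrite !mxE !lift_max.
Qed.

Lemma orth_poly_lead n : D n != 0 -> (P n)`_n = 1.
Proof.
move=> Dn; rewrite coefZ coef_poly ltnSn.
have -> : inord n = ord_max :> 'I_n.+1 by apply/val_inj; rewrite /= inordK.
by rewrite hankel_cofactor mulVf.
Qed.

Lemma orth_poly_size n : D n != 0 -> size (P n) = n.+1.
Proof.
move=> Dn; apply/eqP; rewrite eqn_leq orth_poly_size_le ltnNge.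
by apply/negP => /leq_sizeP /(_ n (leqnn n)) /eqP; rewrite orth_poly_lead// oner_eq0.
Qed.

Lemma orth_poly_monic n : D n != 0 -> P n \is monic.
Proof.
by move=> Dn; rewrite monicE lead_coefE orth_poly_size// orth_poly_lead.
Qed.

(** Column [ord_max] of [A * adj A = det A]. *)
Lemma orth_poly_moment n (j : 'I_n.+1) :
  L (P n * 'X^j) = (j == ord_max)%:R * (D n.+1 / D n).
Proof.
rewrite mom_mulXn momZ (@mom_widen _ _ _ n.+1) ?size_poly//.
have /matrixP /(_ j ord_max) := mul_mx_adj (hankel_mx m n.+1).
rewrite !mxE -[_ *+ _]mulr_natl => H.
rewrite mulrA mulrC -H; congr (_ * _).
apply: eq_bigr => i _; rewrite coef_poly ltn_ord inord_val !mxE mulrC.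
by rewrite addnC.
Qed.

Lemma orth_poly_orth n p : (size p <= n)%N -> L (P n * p) = 0.
Proof.
move=> sp; have -> : p = \sum_(i < n) p`_i *: 'X^i.
  rewrite -poly_def -{1}[p]coefK; apply/polyP => i; rewrite !coef_poly.
  case: ltnP => [/leq_trans->//|pi]; case: ltnP => // _.
  by rewrite nth_default.
rewrite mulr_sumr raddf_sum big1// => i _.
rewrite -scalerAr /= momZ.
have := orth_poly_moment (widen_ord (leqnSn n) i); rewrite /= => ->.
by rewrite -val_eqE/= ltn_eqF// mul0r mulr0.
Qed.

Lemma orth_poly_norm n : D n != 0 -> L (P n * P n) = D n.+1 / D n.
Proof.
move=> Dn; have sX : (size ('X^n : {poly F}) <= n.+1)%N by rewrite size_polyXn.
have := orth_poly_moment (@ord_max n); rewrite eqxx mul1r => <- /=.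
have [r sr Er] := poly_split_monic (orth_poly_monic Dn) (orth_poly_size Dn) sX.
by rewrite Er mulrDr momD (orth_poly_orth sr) addr0 coefXn eqxx scale1r.
Qed.

End Hankel.

(** Successive determinants differ by the factor [L (P n * P n)]. *)
Lemma hankel_det_gt0 (F : realFieldType) (m : nat -> F) :
  (forall p : {poly F}, p != 0 -> 0 < mom m (p * p)) ->
  forall n, 0 < \det (hankel_mx m n).
Proof.
move=> Lpos; elim=> [|n IHn]; first by rewrite det_mx00.
have Dn : \det (hankel_mx m n) != 0 by rewrite gt_eqF.
have := Lpos _ (monic_neq0 (orth_poly_monic Dn)).
by rewrite orth_poly_norm// pmulr_lgt0// invr_gt0.
Qed.

(** * Differentiation of determinants and functionals *)

Section Derivatives.
Context {R : realType}.
Implicit Types (t : R).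

Lemma derivable_big_sum (I : Type) (r : seq I) (f : I -> R -> R) t :
  (forall i, derivable (f i) t 1) ->
  derivable (fun s => \sum_(i <- r) f i s) t 1.
Proof.
move=> df; elim: r => [|i r IHr].
  by under eq_fun do rewrite big_nil; exact: derivable_cst.
by under eq_fun do rewrite big_cons; exact: derivableD.
Qed.

Lemma derivable_big_prod (I : Type) (r : seq I) (f : I -> R -> R) t :
  (forall i, derivable (f i) t 1) ->
  derivable (fun s => \prod_(i <- r) f i s) t 1.
Proof.
move=> df; elim: r => [|i r IHr].
  by under eq_fun do rewrite big_nil; exact: derivable_cst.
by under eq_fun do rewrite big_cons; exact: derivableM.
Qed.

Lemma derivable_det n (A : R -> 'M[R]_n) t :
  (forall i j, derivable (fun s => A s i j) t 1) ->
  derivable (fun s => \det (A s)) t 1.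
Proof.
move=> dA; apply: derivable_big_sum => u.
apply: derivableM; first exact: derivable_cst.
by apply: derivable_big_prod => i.
Qed.

(** Coefficientwise derivative of a family of polynomials of uniformly bounded
    size; the bound turns functionals of the family into finite sums. *)
Definition poly_derive (P : R -> {poly R}) t (dP : {poly R}) n :=
  [/\ forall s, (size (P s) <= n)%N, (size dP <= n)%N
    & forall i, is_derive t 1 (fun s => (P s)`_i) dP`_i].

Lemma poly_derive_cst p t : poly_derive (fun=> p) t 0 (size p).
Proof.
split => // [|i]; first by rewrite size_poly0.
by rewrite coef0; exact: is_derive_cst.
Qed.

Lemma is_derive_sum_fun n (f : 'I_n -> R -> R) t (df : 'I_n -> R) :
  (forall i, is_derive t 1 (f i) (df i)) ->
  is_derive t 1 (fun s => \sum_(i < n) f i s) (\sum_(i < n) df i).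
Proof.
move=> dfE; have := is_derive_sum dfE; congr is_derive.
by apply/funext => s; rewrite fct_sumE.
Qed.

Lemma poly_deriveM P Q t dP dQ n k :
  poly_derive P t dP n -> poly_derive Q t dQ k ->
  poly_derive (fun s => P s * Q s) t (dP * Q t + P t * dQ) (n + k).
Proof.
move=> [sP sdP dPE] [sQ sdQ dQE].
have sM (p q : {poly R}) : (size p <= n)%N -> (size q <= k)%N ->
    (size (p * q)%R <= n + k)%N.
  move=> sp sq; rewrite (leq_trans (size_polyMleq _ _))//.
  by rewrite (leq_trans (leq_pred _))// leq_add.
split=> [s||i]; first exact: sM.
  by rewrite (leq_trans (size_polyD _ _))// geq_max !sM.
under eq_fun do rewrite coefM.
rewrite coefD !coefM -big_split/=.
apply: is_derive_sum_fun => j.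
have := is_deriveM (dPE j) (dQE (i - j)%N); move=> /is_derive_eq; apply.
by rewrite /GRing.scale/=; ring.
Qed.

Lemma poly_deriveZ (c : R -> R) P t dc dP n :
  is_derive t 1 c dc -> poly_derive P t dP n ->
  poly_derive (fun s => c s *: P s) t (dc *: P t + c t *: dP) n.
Proof.
move=> dcE [sP sdP dPE].
have sZ a (p : {poly R}) : (size p <= n)%N -> (size (a *: p)%R <= n)%N.
  by move=> sp; rewrite (leq_trans (size_scale_leq _ _)).
split=> [s||i]; first exact: sZ.
  by rewrite (leq_trans (size_polyD _ _))// geq_max !sZ.
under eq_fun do rewrite coefZ.
rewrite coefD !coefZ; have := is_deriveM dcE (dPE i); move=> /is_derive_eq; apply.
by rewrite /GRing.scale/=; ring.
Qed.

Lemma is_derive_mom (m : R -> nat -> R) dm P t dP n :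
  (forall k, is_derive t 1 (m ^~ k) (dm k)) -> poly_derive P t dP n ->
  is_derive t 1 (fun s => mom (m s) (P s)) (mom dm (P t) + mom (m t) dP).
Proof.
move=> dmE [sP sdP dPE].
have -> : (fun s => mom (m s) (P s)) = (fun s => \sum_(i < n) (P s)`_i * m s i).
  by apply/funext => s; exact: mom_widen.
rewrite (mom_widen _ (sP t)) (mom_widen _ sdP) -big_split/=.
apply: is_derive_sum_fun => i.
have := is_deriveM (dPE i) (dmE i); move=> /is_derive_eq; apply.
by rewrite /GRing.scale/=; ring.
Qed.

End Derivatives.

Lemma momN (F : fieldType) (m : nat -> F) p : mom (fun k => - m k) p = - mom m p.
Proof. by rewrite /mom -sumrN; apply: eq_bigr => i _; rewrite mulrN. Qed.

Lemma is_derive_unique (R : realType) (f : R -> R) (t a b : R) :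
  is_derive t 1 f a -> is_derive t 1 f b -> a = b.
Proof. by move=> [_ <-] [_ <-]. Qed.

Lemma near_neg (R : realType) (t : R) (K : R -> Prop) :
  (forall s, s < 0 -> K s) -> t < 0 -> \forall s \near t, K s.
Proof.
move=> K0 t0; near=> s; apply: K0; near: s; exact: lt_nbhsl.
Unshelve. all: by end_near. Qed.

(** * Orthogonal polynomials of a moving weight *)

Section MomentFlow.
Local Open Scope classical_set_scope.
Context {R : realType}.
Variables (mu nu : R -> nat -> R).
Hypothesis mu_derive : forall t : R, t < 0 ->
  forall k, is_derive t 1 (mu ^~ k) (- nu t k).
Hypothesis mu_pos : forall t : R, t < 0 ->
  forall p : {poly R}, p != 0 -> 0 < mom (mu t) (p * p).
Implicit Types (t : R).
Local Notation D n t := (\det (hankel_mx (mu t) n)).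
Local Notation P n t := (orth_poly (mu t) n).

Lemma det_gt0 n t : t < 0 -> 0 < D n t.
Proof. by move=> t0; apply: hankel_det_gt0; exact: mu_pos. Qed.

Lemma det_neq0 n t : t < 0 -> D n t != 0.
Proof. by move=> t0; rewrite gt_eqF ?det_gt0. Qed.

Lemma derivable_mu k t : t < 0 -> derivable (mu ^~ k) t 1.
Proof. by move=> /mu_derive /(_ k) []. Qed.

Lemma derivable_hankel n t : t < 0 -> derivable (fun s => D n s) t 1.
Proof.
move=> t0; apply: derivable_det => i j.
under eq_fun do rewrite mxE.
exact: derivable_mu.
Qed.

Lemma derivable_orth_coef n k t : t < 0 -> derivable (fun s => (P n s)`_k) t 1.
Proof.
move=> t0; have [kn|nk] := ltnP k n.+1; last first.
  under eq_fun do rewrite nth_default ?(leq_trans (orth_poly_size_le _ _))//.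
  exact: derivable_cst.
under eq_fun do rewrite coefZ coef_poly kn.
apply: derivableM.
  by apply: derivableV; [exact: det_neq0|exact: derivable_hankel].
rewrite /cofactor; apply: derivableM; first exact: derivable_cst.
apply: derivable_det => i j.
under eq_fun do rewrite !mxE.
exact: derivable_mu.
Qed.

(** Differentiating a constant pairing trades the variation of the polynomial for
    that of the functional, which is [- nu]. *)
Lemma derive_pairing (f : R -> {poly R}) (df p : {poly R}) t n (c : R) :
  t < 0 -> poly_derive f t df n ->
  (forall s, s < 0 -> mom (mu s) (f s * p) = c) ->
  mom (mu t) (df * p) = mom (nu t) (f t * p).
Proof.
move=> t0 dfE fpc.
have d1 := is_derive_mom (mu_derive t0) (poly_deriveM dfE (poly_derive_cst p t)).
have d2 : is_derive t 1 (fun s => mom (mu s) (f s * p)) 0.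
  apply: near_eq_is_derive (is_derive_cst c t 1).
  by apply: near_neg t0 => s s0; rewrite fpc.
have := is_derive_unique d1 d2.
by rewrite momN mulr0 addr0 => /eqP; rewrite addrC subr_eq0 => /eqP.
Qed.

Lemma orth_poly_derive n t : t < 0 -> exists dP : {poly R},
  [/\ poly_derive (fun s => P n s) t dP n.+1, (size dP <= n)%N
    & forall p : {poly R}, (size p <= n)%N ->
        mom (mu t) (dP * p) = mom (nu t) (P n t * p)].
Proof.
move=> t0; pose dP := \poly_(k < n.+1) 'D_1 (fun s => (P n s)`_k) t.
have dPE : poly_derive (fun s => P n s) t dP n.+1.
  split=> [s||k]; [exact: orth_poly_size_le|exact: size_poly|].
  rewrite coef_poly; case: ltnP => [_|nk].
    by apply: DeriveDef => //; exact: derivable_orth_coef.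
  under eq_fun do rewrite nth_default ?(leq_trans (orth_poly_size_le _ _))//.
  exact: is_derive_cst.
exists dP; split=> //.
  apply/leq_sizeP => k; rewrite leq_eqVlt => /predU1P[<-|nk]; last first.
    by rewrite nth_default// (leq_trans (size_poly _ _)).
  have [_ _ dn] := dPE; apply: is_derive_unique (dn n) _.
  apply: near_eq_is_derive (is_derive_cst (1 : R) t 1).
  by apply: near_neg t0 => s s0; rewrite orth_poly_lead ?det_neq0.
move=> p sp; apply: (derive_pairing t0 dPE (c := 0)) => s s0.
exact: orth_poly_orth.
Qed.

(** The variation of a monic polynomial has lower degree, so it is orthogonal to
    [P n]. *)
Lemma orth_norm_derive n t : t < 0 ->
  is_derive t 1 (fun s => mom (mu s) (P n s * P n s))
    (- mom (nu t) (P n t * P n t)).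
Proof.
move=> t0; have [dP [dPE sdP dPo]] := orth_poly_derive n t0.
have := is_derive_mom (mu_derive t0) (poly_deriveM dPE dPE).
move=> /is_derive_eq; apply.
by rewrite momN momD [dP * _]mulrC orth_poly_orth// !addr0.
Qed.

Lemma orth_norm_neq0 n t : t < 0 -> mom (mu t) (P n t * P n t) != 0.
Proof.
by move=> t0; rewrite gt_eqF// mu_pos// monic_neq0// orth_poly_monic// det_neq0.
Qed.

Lemma hankel_step n t : t < 0 -> D n.+1 t = mom (mu t) (P n t * P n t) * D n t.
Proof. by move=> t0; rewrite orth_poly_norm ?det_neq0// divfK ?det_neq0. Qed.

(** [G] is the candidate for the logarithmic derivative of the determinants. *)
Lemma hankel_derive (G : nat -> R) t : t < 0 -> G 0 = 0 ->
  (forall n, G n.+1 = G n - mom (nu t) (P n t * P n t) / mom (mu t) (P n t * P n t)) ->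
  forall n, is_derive t 1 (fun s => D n s) (D n t * G n).
Proof.
move=> t0 G0 GS; elim=> [|n IHn].
  rewrite G0 mulr0; under eq_fun do rewrite det_mx00.
  exact: is_derive_cst.
have d := is_deriveM (orth_norm_derive n t0) IHn.
apply: near_eq_is_derive (is_derive_eq d _).
  by apply: near_neg t0 => s s0; rewrite hankel_step.
have h0 := orth_norm_neq0 n t0.
by rewrite hankel_step// GS /GRing.scale/=; field.
Qed.

Definition dual_poly n t := (mom (mu t) (P n t * P n t))^-1 *: P n t.

Lemma dual_poly_size n t : (size (dual_poly n t) <= n.+1)%N.
Proof. by rewrite (leq_trans (size_scale_leq _ _))// orth_poly_size_le. Qed.

Lemma dual_poly_dual n t (p : {poly R}) : t < 0 -> (size p <= n.+1)%N ->
  mom (mu t) (dual_poly n t * p) = p`_n.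
Proof.
move=> t0 sp; have Dn := det_neq0 n t0.
rewrite -scalerAl momZ.
have orthP r := @orth_poly_orth _ (mu t) n r.
rewrite (orth_lead (orth_poly_monic Dn) (orth_poly_size Dn) orthP sp).
by rewrite mulrCA mulVf ?orth_norm_neq0// mulr1.
Qed.

Lemma dual_poly_derive n t : t < 0 -> exists dq : {poly R},
  [/\ poly_derive (dual_poly n) t dq n.+1, (size dq <= n.+1)%N
    & forall p : {poly R}, (size p <= n.+1)%N ->
        mom (mu t) (dq * p) = mom (nu t) (dual_poly n t * p)].
Proof.
move=> t0; have [dP [dPE sdP dPo]] := orth_poly_derive n t0.
have h0 := orth_norm_neq0 n t0.
have dh := is_deriveV h0 (orth_norm_derive n t0).
have dqE := poly_deriveZ dh dPE.
eexists; split; [exact: dqE|by case: dqE|] => p sp.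
apply: (derive_pairing t0 dqE (c := p`_n)) => s s0.
exact: dual_poly_dual.
Qed.

End MomentFlow.

(** * The Jacobi weight and its moments *)

Section Weight.
Local Open Scope classical_set_scope.
Context {R : realType}.
Implicit Types (a b c t x : R) (f g : R -> R).

Lemma derivable_oo_LRcontinuousM f g a b :
  derivable_oo_LRcontinuous f a b -> derivable_oo_LRcontinuous g a b ->
  derivable_oo_LRcontinuous (fun x => f x * g x) a b.
Proof.
move=> [df fa fb] [dg ga gb]; split.
- by move=> x xab; apply: derivableM; [exact: df|exact: dg].
- exact: cvgM.
- exact: cvgM.
Qed.

Lemma derivable_continuous_at f x : derivable f x 1 -> f y @[y --> x] --> f x.
Proof. by move=> /derivable1_diffP /differentiable_continuous. Qed.

Lemma derivable_LRcontinuous f a b : (forall x, a <= x <= b -> derivable f x 1) ->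
  a <= b -> derivable_oo_LRcontinuous f a b.
Proof.
move=> df ab.
have cf x : a <= x <= b -> f y @[y --> x] --> f x.
  by move=> /df /derivable_continuous_at.
split.
- by move=> x; rewrite in_itv/= => /andP[ax xb]; apply: df; rewrite !ltW.
- by apply: cvg_at_right_filter; apply: cf; rewrite lexx.
- by apply: cvg_at_left_filter; apply: cf; rewrite lexx andbT.
Qed.

Lemma powR_LRcontinuous a : 0 < a ->
  derivable_oo_LRcontinuous (fun x => x `^ a) 0 1.
Proof.
move=> a0; split.
- move=> x; rewrite in_itv/= => /andP[x0 _].
  by apply: derivable_powR; rewrite in_itv/= x0.
- by rewrite powR0 ?gt_eqF//; exact: powR_cvg0.
- apply/cvg_at_left_filter/derivable_continuous_at.
  by apply: derivable_powR; rewrite in_itv/= ltr01.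
Qed.

Lemma is_derive_powR_onem b x : x < 1 ->
  is_derive x 1 (fun x => (1 - x) `^ b) (- (b * (1 - x) `^ (b - 1))).
Proof.
move=> x1; have x1' : 0 < 1 - x by rewrite subr_gt0.
have := @is_derive1_comp _ (fun y => y `^ b) (fun x : R => 1 - x) x _ (-1)
  (@is_derive1_powR R b _ x1') _.
have d1 : is_derive x 1 (fun x : R => 1 - x) (-1).
  by apply: is_derive_eq; ring.
by move=> /(_ d1) /is_derive_eq; apply; rewrite mulrN1.
Qed.

Lemma powR_onem_LRcontinuous b : 0 < b ->
  derivable_oo_LRcontinuous (fun x => (1 - x) `^ b) 0 1.
Proof.
move=> b0; split.
- move=> x; rewrite in_itv/= => /andP[_ x1].
  by have [] := is_derive_powR_onem b x1.
- apply/cvg_at_right_filter/derivable_continuous_at.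
  by have [] := is_derive_powR_onem b (@ltr01 R).
- rewrite subrr powR0 ?gt_eqF//.
  apply: (@cvg_comp _ _ _ (fun x => 1 - x) (fun y => y `^ b) _ (0^'+)).
    move=> A /= [e e0 eA]; exists e => // y /= ye y1.
    apply: eA; rewrite /= ?subr_gt0//.
    by rewrite sub0r normrN.
  exact: powR_cvg0.
Qed.

Lemma is_derive_powR_shift c t x : t < x ->
  is_derive x 1 (fun x => (x - t) `^ c) (c * (x - t) `^ (c - 1)).
Proof.
move=> tx; have tx' : 0 < x - t by rewrite subr_gt0.
have := @is_derive1_comp _ (fun y => y `^ c) (fun x : R => x - t) x _ 1
  (@is_derive1_powR R c _ tx') _.
have d1 : is_derive x 1 (fun x : R => x - t) 1.
  by apply: is_derive_eq; ring.
by move=> /(_ d1) /is_derive_eq; apply; rewrite mulr1.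
Qed.

Lemma weight_LRcontinuous a b c t (p : {poly R}) : 0 < a -> 0 < b -> t < 0 ->
  derivable_oo_LRcontinuous (fun x => p.[x] * jacobi_weight a b c x t) 0 1.
Proof.
move=> a0 b0 t0; apply: derivable_oo_LRcontinuousM.
  by apply: derivable_LRcontinuous => // x _; exact: derivable_poly.
apply: derivable_oo_LRcontinuousM; last exact: powR_onem_LRcontinuous.
apply: derivable_oo_LRcontinuousM; last exact: powR_LRcontinuous.
apply: derivable_LRcontinuous => // x /andP[x0 _].
by have [] := is_derive_powR_shift c (lt_le_trans t0 x0).
Qed.

End Weight.

Definition moment (R : realType) (a b c t : R) (k : nat) : R :=
  \int[lebesgue_measure]_(x in `[0, 1]%classic)
    (x ^+ k * jacobi_weight a b c x t).

Section Moments.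
Local Open Scope classical_set_scope.
Context {R : realType}.
Variables (a b : R).
Hypotheses (a_gt0 : 0 < a) (b_gt0 : 0 < b).
Implicit Types (c t x : R) (p q : {poly R}).
Local Notation mu := (@lebesgue_measure R).
Local Notation w c t x := (jacobi_weight a b c x t).

Lemma weight_continuous c t p : t < 0 ->
  {within `[0, 1], continuous (fun x => p.[x] * w c t x)}.
Proof.
by move=> t0; apply/derivable_oo_LRcontinuous_within/weight_LRcontinuous.
Qed.

Lemma weight_integrable c t p : t < 0 ->
  mu.-integrable `[0, 1] (EFin \o (fun x => p.[x] * w c t x)).
Proof.
move=> t0; apply: continuous_compact_integrable.
  exact: segment_compact.
exact: weight_continuous.
Qed.

Lemma Rintegral_weight c t p : t < 0 ->
  \int[mu]_(x in `[0, 1]) (p.[x] * w c t x) = mom (moment a b c t) p.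
Proof.
move=> t0; pose P n := \poly_(i < n) p`_i.
suff sP n : \int[mu]_(x in `[0, 1]) ((P n).[x] * w c t x) =
    \sum_(i < n) p`_i * moment a b c t i.
  by rewrite -[in LHS](coefK p) sP.
elim: n => [|n IHn].
  rewrite big_ord0 -[RHS](Rintegral_set0 mu (fun=> 0)).
  transitivity (\int[mu]_(x in `[0%R, 1%R]) (0 : R)).
    by apply: eq_Rintegral => x _; rewrite /P poly_def big_ord0 horner0 mul0r.
  by rewrite Rintegral_cst// mul0r Rintegral_set0.
transitivity (\int[mu]_(x in `[0, 1])
    ((P n).[x] * w c t x + p`_n * ('X^n.[x] * w c t x))).
  apply: eq_Rintegral => x _.
  rewrite /P !poly_def big_ord_recr/= !hornerE/=; ring.
have iXn : mu.-integrable `[0%R, 1%R]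
    (EFin \o (fun x => 'X^n.[x] * w c t x)) by exact: weight_integrable.
rewrite RintegralD//; last 2 first.
- exact: weight_integrable.
- have := weight_integrable c (p`_n *: 'X^n) t0; congr integrable.
  by apply/funext => x /=; rewrite hornerZ mulrA.
rewrite IHn RintegralZl// big_ord_recr/=; congr (_ + _ * _).
by apply: eq_Rintegral => x _; rewrite hornerXn.
Qed.

Lemma powR_pred x c : 0 < x -> x * x `^ (c - 1) = x `^ c.
Proof.
move=> x0; rewrite -{1}(powRr1 (ltW x0)) -powRD ?(gt_eqF x0) ?implybT//.
by congr (_ `^ _); ring.
Qed.

Lemma weight_shift c t x : t < x -> (x - t) * w (c - 1) t x = w c t x.
Proof.
by move=> tx; rewrite /jacobi_weight -(@powR_pred (x - t) c) ?subr_gt0// !mulrA.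
Qed.

Lemma moment_shift c t k : t < 0 ->
  moment a b (c - 1) t k.+1 = t * moment a b (c - 1) t k + moment a b c t k.
Proof.
move=> t0.
have := Rintegral_weight (c - 1) ('X^(k.+1) - t *: 'X^k) t0.
rewrite momB momZ !momXn => E.
suff -> : moment a b c t k = moment a b (c - 1) t k.+1 - t * moment a b (c - 1) t k.
  by ring.
rewrite -E; apply: eq_Rintegral => x; rewrite inE/= in_itv/= => /andP[x0 _].
rewrite -weight_shift ?(lt_le_trans t0)// !hornerE exprS/=; ring.
Qed.

(** Integral of the derivative of [x (1 - x) p w], which vanishes at both
    ends. *)
Lemma weight_pearson c t p (q := 'X * (1 - 'X) * p) : t < 0 ->
  mom (moment a b c t) (q^`() + (a *: (1 - 'X) - b *: 'X) * p)
  + mom (moment a b (c - 1) t) (c *: q) = 0.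
Proof.
move=> t0.
set r := q^`() + _.
rewrite -(Rintegral_weight c r t0) -(Rintegral_weight (c - 1) (c *: q) t0).
rewrite -RintegralD; [|by []|exact: weight_integrable..].
pose F x := q.[x] * w c t x.
pose f x := r.[x] * w c t x + (c *: q).[x] * w (c - 1) t x.
have F'f x : 0 < x < 1 -> is_derive x 1 F (f x).
  move=> /andP[x0 x1].
  have tx := lt_trans t0 x0.
  have d1 := is_derive_powR_shift c tx.
  have d2 := is_derive1_powR a x0.
  have d3 := is_derive_powR_onem b x1.
  have dq := is_derive_poly q x.
  have := is_deriveM dq (is_deriveM (is_deriveM d1 d2) d3).
  move=> /is_derive_eq; apply.
  rewrite /f /r /jacobi_weight hornerD !fctE/=.
  move: (q^`().[x]) => D; rewrite /q !hornerE/=.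
  rewrite -(@powR_pred (x - t) c) ?subr_gt0//.
  rewrite -(@powR_pred x a)// -(@powR_pred (1 - x) b) ?subr_gt0//.
  rewrite /GRing.scale/=.
  ring.
have cf : {within `[0, 1], continuous f}.
  by move=> x; apply: cvgD; exact: weight_continuous.
have := @continuous_FTC2 R f F 0 1 ltr01 cf (weight_LRcontinuous c q a_gt0 b_gt0 t0).
have F0 : F 0 = 0 by rewrite /F /q !hornerE/=; ring.
have F1 : F 1 = 0 by rewrite /F /q !hornerE/=; ring.
rewrite F0 F1 sube0 => fF.
rewrite /Rintegral fF// => x; rewrite in_itv/= => x01.
by rewrite derive1E; have [_] := F'f x x01.
Qed.

Lemma moment_pearson c t k : t < 0 ->
  k.+1%:R * moment a b c t k - k.+2%:R * moment a b c t k.+1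
  + a * (moment a b c t k - moment a b c t k.+1) - b * moment a b c t k.+1
  + c * (moment a b (c - 1) t k.+1 - moment a b (c - 1) t k.+2) = 0.
Proof.
move=> t0; by rewrite -(weight_pearson c 'X^k t0) mom_pearsonXn.
Qed.

Lemma weight_gt0 c t x : t < 0 -> 0 < x < 1 -> 0 < w c t x.
Proof.
move=> t0 /andP[x0 x1].
by rewrite /jacobi_weight !mulr_gt0 ?powR_gt0 ?subr_gt0// (lt_trans t0).
Qed.

Lemma finite_roots p : p != 0 -> finite_set [set x | root p x].
Proof.
move=> p0; apply: contrapT => /infinite_set_fset => /(_ (size p)) [B Bp].
rewrite leqNgt => /negP; apply; apply: max_poly_roots => //.
  by apply/allP => x xB; exact: Bp.
exact: finmap.fset_uniq.
Qed.

(** A nonnegative integrand with zero integral vanishes almost everywhere, but the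
    integrand [p^2 w] vanishes at finitely many points of the interval only. *)
Lemma mom_sqr_gt0 c t p : t < 0 -> p != 0 -> 0 < mom (moment a b c t) (p * p).
Proof.
move=> t0 p0; rewrite -Rintegral_weight//.
pose g x := (p * p).[x] * w c t x.
have g0 x : 0 <= g x.
  by rewrite /g hornerM -expr2 mulr_ge0 ?sqr_ge0// !mulr_ge0 ?powR_ge0.
have ig : mu.-integrable `[0%R, 1%R] (EFin \o g) by exact: weight_integrable.
rewrite lt_neqAle; apply/andP; split; last by apply: Rintegral_ge0 => x _; exact: g0.
rewrite eq_sym; apply/negP => /eqP ig0.
have /integrableP[mg _] := ig.
have : (\int[mu]_(x in `[0%R, 1%R]) `|(EFin \o g) x| = 0)%E.
  transitivity (\int[mu]_(x in `[0%R, 1%R]) (g x)%:E)%E.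
    by apply: eq_integral => x _ /=; rewrite ger0_norm.
  by rewrite -(fineK (integrable_fin_num _ ig))//; congr EFin.
move=> /(ae_eq_integral_abs mu (measurable_itv _) mg) ae0.
have : mu.-negligible (`]0%R, 1%R[ : set R).
  have nr : mu.-negligible [set x | root p x].
    apply/negligibleP.
      apply: countable_measurable => [x|]; first exact: measurable_set1.
      by apply: finite_set_countable; exact: finite_roots.
    apply: countable_lebesgue_measure0; apply: finite_set_countable.
    exact: finite_roots.
  apply: negligibleS (negligibleU nr ae0) => x /=.
  rewrite in_itv/= => x01; have [rx|nrx] := boolP (root p x); [by left|right].
  apply/not_implyP; split; first by rewrite in_itv/= !ltW//; case/andP: x01.
  move=> [] /eqP; rewrite /g mulf_eq0 hornerM mulf_eq0 orbb.
  by rewrite (gt_eqF (weight_gt0 _ t0 x01)) orbF => rx; rewrite /root rx in nrx.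
move=> /(negligibleP mu (measurable_itv _)) H.
have := @lebesgue_measure_itv R (Interval (BRight 0) (BLeft 1)).
rewrite [LHS]H/= lte_fin ltr01 sube0 => /esym/eqP.
by rewrite eqe oner_eq0.
Qed.

(** Covers both signs of the exponent. *)
Lemma powR_between e l u x : 0 < l -> l <= x <= u -> x `^ e <= l `^ e + u `^ e.
Proof.
move=> l0 /andP[lx xu]; have x0 := lt_le_trans l0 lx.
have u0 := lt_le_trans x0 xu.
have [e0|e0] := leP 0 e.
  rewrite (@le_trans _ _ (u `^ e)) ?lerDr ?powR_ge0//.
  by apply: ge0_ler_powR; rewrite ?nnegrE// ltW.
rewrite (@le_trans _ _ (l `^ e)) ?lerDl ?powR_ge0//.
rewrite -(opprK e) !(powRN _ (- e)) lef_pV2 ?posrE ?powR_gt0//.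
by apply: ge0_ler_powR; rewrite ?nnegrE ?oppr_ge0// ltW.
Qed.

(** Differentiation under the integral sign.  For [s] between [2 t] and [t / 2],
    [x - s] stays between [- t / 2] and [1 - 2 t], so the derivative of the
    integrand is bounded by a constant. *)
Lemma moment_is_derive c t k : t < 0 ->
  is_derive t 1 (fun s => moment a b c s k) (- (c * moment a b (c - 1) t k)).
Proof.
move=> t0.
pose f s x := x ^+ k * w c s x.
pose f' s x := - (c * (x ^+ k * w (c - 1) s x)).
have f'E s x : s < x -> is_derive s 1 (f ^~ x) (f' s x).
  move=> sx; have sx0 : 0 < x - s by rewrite subr_gt0.
  have d1 : is_derive s 1 (fun s : R => x - s) (-1) by apply: is_derive_eq; ring.
  have d2 := @is_derive1_comp R (fun y => y `^ c) (fun s : R => x - s) s _ _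
    (@is_derive1_powR R c _ sx0) d1.
  have -> : f ^~ x = (fun s => (x ^+ k * x `^ a * (1 - x) `^ b) * (x - s) `^ c).
    by apply/funext => s'; rewrite /f /jacobi_weight; ring.
  have := is_deriveM (is_derive_cst (x ^+ k * x `^ a * (1 - x) `^ b) s 1) d2.
  move=> /is_derive_eq; apply.
  rewrite /f' /jacobi_weight /GRing.scale/=; ring.
have sub0 s x : 2 * t < s < t / 2 -> 0 <= x <= 1 -> s < x.
  by move=> /andP[_ st] /andP[x0 _]; lra.
have I0 : `]2 * t, t / 2[ t by rewrite /= in_itv/=; lra.
have intf s : `]2 * t, t / 2[ s -> mu.-integrable `[0, 1] (EFin \o f s).
  rewrite /= in_itv/= => /andP[_ st].
  have s0 : s < 0 by lra.
  have := weight_integrable c 'X^k s0; congr integrable.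
  by apply/funext => x /=; rewrite hornerXn.
have derf s x : `]2 * t, t / 2[ s -> `[0, 1] x -> derivable (f ^~ x) s 1.
  by rewrite /= in_itv/= => st x01; have [] := f'E _ _ (sub0 _ _ st x01).
pose C := `|c| * ((- t / 2) `^ (c - 1) + (1 - 2 * t) `^ (c - 1)).
have d1f s x : `]2 * t, t / 2[ s -> `[0, 1] x -> partial1of2 f s x = f' s x.
  rewrite /= in_itv/= => st x01.
  by rewrite partial1of2E; have [_] := f'E _ _ (sub0 _ _ st x01).
have ub s x : `]2 * t, t / 2[ s -> `[0, 1] x -> `|partial1of2 f s x| <= C.
  move=> Is Ix; rewrite d1f// /f' normrN normrM ler_wpM2l//.
  move: Is Ix; rewrite /= !in_itv/= => Is Ix.
  have /andP[x0 x1] := Ix.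
  have x'0 : 0 <= 1 - x by rewrite subr_ge0.
  have x'1 : 1 - x <= 1 by rewrite gerBl.
  have powR_le1 (e y : R) : 0 < e -> 0 <= y -> y <= 1 -> y `^ e <= 1.
    move=> e0 y0 y1; have -> : 1 = 1 `^ e :> R by rewrite powR1.
    by apply: ge0_ler_powR; rewrite ?nnegrE// ltW.
  rewrite /jacobi_weight ger0_norm; last first.
    by rewrite !mulr_ge0 ?powR_ge0 ?exprn_ge0.
  have K0 := @powR_ge0 R (x - s) (c - 1).
  have K1 : (x - s) `^ (c - 1) <= (- t / 2) `^ (c - 1) + (1 - 2 * t) `^ (c - 1).
    by apply: powR_between; lra.
  apply: le_trans K1.
  rewrite -[leRHS]mul1r ler_pM ?exprn_ge0 ?exprn_ile1//.
    by rewrite !mulr_ge0 ?powR_ge0.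
  rewrite -[leRHS]mulr1 ler_pM ?powR_ge0 ?powR_le1 ?mulr_ge0 ?powR_ge0//.
  by rewrite -[leRHS]mulr1 ler_pM ?powR_ge0 ?powR_le1.
have intC : mu.-integrable `[0, 1] (EFin \o cst C).
  apply: continuous_compact_integrable; first exact: segment_compact.
  by move=> x; exact: cvg_cst.
have C0 (x : R) : 0 <= cst C x by rewrite /= mulr_ge0// addr_ge0// powR_ge0.
have m01 : measurable (`[0, 1] : set R) by exact: measurable_itv.
have D := @derivable_under_integral R _ _ mu f `[0, 1] m01 t _ _ I0 intf derf
  (cst C) C0 intC ub.
have E := @differentiation_under_integral R _ _ mu f `[0, 1] m01 t _ _ I0 intf derf
  (cst C) C0 intC ub.
apply: DeriveDef => //.
rewrite -derive1E [LHS]E.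
transitivity (\int[mu]_(x in `[0, 1]) ((- c) * (x ^+ k * w (c - 1) t x))).
  apply: eq_Rintegral => x; rewrite inE => x01; rewrite d1f// /f'; ring.
rewrite RintegralZl ?mulNr//.
have := weight_integrable (c - 1) 'X^k t0; congr integrable.
by apply/funext => x /=; rewrite hornerXn.
Qed.

End Moments.

Lemma mom_lincomb (F : fieldType) (c b g : F) (d v e : nat -> F) (p : {poly F}) :
  (forall k, c * d k = b * v k - g * e k) ->
  c * mom d p = b * mom v p - g * mom e p.
Proof.
move=> cd; rewrite /mom !mulr_sumr -sumrB; apply: eq_bigr => i _.
by rewrite mulrCA cd; ring.
Qed.

(** * The Schlesinger flow of the Jacobi weight *)

(** Scalar identities, over an arbitrary field so that [ring] compares moments
    only as variables. *)
Section Identities.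
Context {F : fieldType}.
Implicit Types (a b c g t : F).

Lemma pearson_scale a b c g x0 x1 y1 y2 :
  c * x0 - (c + 1) * x1 + a * (x0 - x1) - b * x1 + (g - 1) * (y1 - y2) = 0 ->
  c * (g * x0) - (c + 1) * (g * x1) + a * (g * x0 - g * x1) - b * (g * x1)
  + (g * ((g - 1) * y1) - g * ((g - 1) * y2)) = 0.
Proof. by move=> H; rewrite -[RHS](mulr0 g) -H; ring. Qed.

Lemma distribute_factor x g y1 y2 :
  x + g * (y1 - y2) = 0 -> x + (g * y1 - g * y2) = 0.
Proof. by rewrite mulrBr. Qed.

Lemma cancel_two (x y z : F) : x + y + z - y - z = x.
Proof. by ring. Qed.

Lemma shift_scale t g x0 x1 y : x1 = t * x0 + y ->
  g * ((g - 1) * x1) = t * (g * ((g - 1) * x0)) + (g - 1) * (g * y).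
Proof. by move=> ->; ring. Qed.

Lemma residue1_shift_id a b c m0 m1 n1 n2 :
  c * m0 - (c + 1) * m1 + a * (m0 - m1) - b * m1 + (n1 - n2) = 0 ->
  - ((c + 1) * m1) - n2 - (a + b) * m1 =
  1 * (- (c * m0) - n1 - (a + b) * m0) + b * m0.
Proof. by move=> H; apply: (eq_by_sub H); ring. Qed.

Lemma residue0_shift_id a b c m0 n1 e0 : e0 = - (c * m0) - n1 - (a + b) * m0 ->
  - (c * m0) - n1 - (1 * e0 + b * m0) = a * m0.
Proof. by move=> ->; ring. Qed.

Lemma residue1_flow_id a b g t c m0 n0 n1 k1 k2 :
  n1 = t * n0 + g * m0 -> k2 = t * k1 + (g - 1) * n1 ->
  c * n0 - (c + 1) * n1 + a * (n0 - n1) - b * n1 + (k1 - k2) = 0 ->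
  (1 - t) * (c * n0 + k1 + (a + b) * n0) =
  b * n0 - g * (- (c * m0) - n1 - (a + b) * m0).
Proof. by move=> E1 E2 H; apply: (eq_by_sub H); rewrite E2 E1; ring. Qed.

Lemma log_deriv_id (T x y X N0 N1 : F) : T != 0 -> y != 0 ->
  T * x = - X * y -> N1 = N0 + X -> N1 / T = N0 / T - x / y.
Proof.
move=> T0 y0 H ->; have -> : x = - X * y / T by rewrite -H mulrC mulKf.
by field; rewrite T0 y0.
Qed.

(** [Z1], [E1], [V1] and [Z2], [E2], [V2] are the opposite off-diagonal entries of
    the three residues, [rE], [rV] and [xZ * (xZ - a)] the values imposed by
    singularity. *)
Lemma residue_gram_id (xZ a E1 E2 V1 V2 Z1 Z2 rE rV : F) :
  Z1 + E1 + V1 = 0 -> Z2 + E2 + V2 = 0 ->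
  Z1 * Z2 = xZ * (xZ - a) -> E1 * E2 = rE -> V1 * V2 = rV ->
  E1 * V2 + V1 * E2 = xZ * (xZ - a) - rE - rV.
Proof.
move=> H1 H2 <- <- <-.
have -> : Z1 = - E1 - V1 by apply: (eq_by_sub H1); ring.
have -> : Z2 = - E2 - V2 by apply: (eq_by_sub H2); ring.
ring.
Qed.

End Identities.

Section JacobiFlow.
Context {R : realType}.
Variables (a b g : R).
Hypotheses (a_gt0 : 0 < a) (b_gt0 : 0 < b).
Implicit Types (t s : R).

Local Notation mu := (moment a b g).

(** Moments of [g w / (x - t)], [b w / (x - 1)] and [a w / x].  The last two
    functions may be unbounded near an endpoint; expressing their moments through
    those of the first by integration by parts avoids improper integrals. *)
Definition residuet t k := g * moment a b (g - 1) t k.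
Definition residue1 t k :=
  - (k.+1%:R * mu t k) - residuet t k.+1 - (a + b) * mu t k.
Definition residue0 t k :=
  - (k%:R * mu t k.-1) - residuet t k - residue1 t k.

Local Notation nu := residuet.
Local Notation ep := residue1.
Local Notation ze := residue0.

Lemma residuet_shift t k : t < 0 -> nu t k.+1 = t * nu t k + g * mu t k.
Proof.
by move=> t0; rewrite /residuet (moment_shift a_gt0 b_gt0)// mulrDr mulrCA.
Qed.

Lemma mu_pearson t k : t < 0 ->
  k.+1%:R * mu t k - (k.+1%:R + 1) * mu t k.+1 + a * (mu t k - mu t k.+1)
  - b * mu t k.+1 + (nu t k.+1 - nu t k.+2) = 0.
Proof.
move=> t0; rewrite natr1; apply: distribute_factor.
exact: moment_pearson.
Qed.

Lemma residue1_shift t k : t < 0 -> ep t k.+1 = 1 * ep t k + b * mu t k.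
Proof.
move=> t0; rewrite /residue1 -[k.+2%:R]natr1.
exact: residue1_shift_id (mu_pearson k t0).
Qed.

Lemma residue_sum t k : ze t k + ep t k + nu t k = - (k%:R * mu t k.-1).
Proof. by rewrite /residue0 subrK addrNK. Qed.

Lemma residue0_shift t k : t < 0 -> ze t k.+1 = 0 * ze t k + a * mu t k.
Proof.
move=> t0; rewrite /residue0 residue1_shift//= mul0r add0r.
exact: residue0_shift_id.
Qed.

Lemma moment_residuet_derive t : t < 0 -> forall k, is_derive t 1 (mu ^~ k) (- nu t k).
Proof. by move=> t0 k; exact: moment_is_derive. Qed.

Lemma moment_sqr_pos t : t < 0 -> forall p : {poly R}, p != 0 -> 0 < mom (mu t) (p * p).
Proof. by move=> t0 p; exact: mom_sqr_gt0. Qed.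

(** Partial fractions of [1 / ((x - 1) (x - t))]: the derivative of
    [b w / (x - 1)] in [t] is [- b g w / ((x - 1) (x - t))]. *)
Lemma residue1_derive t : t < 0 -> exists de : nat -> R,
  (forall k, is_derive t 1 (ep ^~ k) (de k)) /\
  (forall k, (1 - t) * de k = b * nu t k - g * ep t k).
Proof.
move=> t0; pose ka k := g * ((g - 1) * moment a b (g - 1 - 1) t k).
have residuet_derive k : is_derive t 1 (nu ^~ k) (- ka k).
  have d := moment_is_derive a_gt0 b_gt0 (g - 1) k t0.
  have := is_deriveM (is_derive_cst g t 1) d; move=> /is_derive_eq; apply.
  by rewrite /= scaler0 addr0 scalerN.
have ka_shift k : ka k.+1 = t * ka k + (g - 1) * nu t k.
  exact: shift_scale (moment_shift a_gt0 b_gt0 (g - 1) k t0).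
exists (fun k => k.+1%:R * nu t k + ka k.+1 + (a + b) * nu t k); split=> k.
  have d1 := is_deriveM (is_derive_cst (k.+1%:R + (a + b)) t 1) (moment_residuet_derive t0 k).
  have d := is_deriveN (is_deriveD d1 (residuet_derive k.+1)).
  have -> : ep ^~ k = - ((fun=> k.+1%:R + (a + b)) * mu ^~ k + nu ^~ k.+1).
    by apply/funext => s; rewrite /residue1 !fctE; ring.
  move: d => /is_derive_eq; apply.
  by rewrite /GRing.scale/=; ring.
apply: (residue1_flow_id (residuet_shift k t0) (ka_shift k.+1)).
have H := moment_pearson a_gt0 b_gt0 (g - 1) k t0.
by apply: pearson_scale; rewrite natr1.
Qed.

Local Notation D n t := (\det (hankel_mx (mu t) n)).
Local Notation P n t := (orth_poly (mu t) n).
Local Notation q n t := (dual_poly mu n t).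

(** Closed form of [t (t - 1) d(ln D_n)/dt]; the coefficient is the subleading one
    of the orthogonal polynomial, with value 0 for [n = 0]. *)
Definition Hn_numerator n t := - (2 * n%:R + a + b + g) * (P n t * 'X)`_n
   + n%:R * g * t - n%:R * (n%:R + a + g).

(** Telescopes [log_deriv_step] over the norms whose product is the
    determinant. *)
Lemma ln_hankel_derive n t : t < 0 ->
  is_derive t 1 (fun s => ln (hankel_det n a b g s))
    (Hn_numerator n t / (t * (t - 1))).
Proof.
move=> t0; have tt0 : t * (t - 1) != 0.
  by rewrite mulf_neq0 ?lt_eqF// subr_lt0 (lt_trans t0).
pose G n := Hn_numerator n t / (t * (t - 1)).
have G0 : G 0 = 0 by rewrite /G /Hn_numerator coefMX/=; ring.
have GS k : G k.+1 = G k - mom (nu t) (P k t * P k t) / mom (mu t) (P k t * P k t).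
  have Dk := det_neq0 moment_sqr_pos k t0; have Dk1 := det_neq0 moment_sqr_pos k.+1 t0.
  have h0 := orth_norm_neq0 moment_sqr_pos k t0.
  have := log_deriv_step (fun k => residue0_shift k t0) (fun k => residue1_shift k t0)
    (fun k => residuet_shift k t0) (residue_sum t)
    (orth_poly_monic Dk) (orth_poly_size Dk) (@orth_poly_orth _ (mu t) k)
    (orth_poly_monic Dk1) (orth_poly_size Dk1) (@orth_poly_orth _ (mu t) k.+1).
  move=> H; apply: log_deriv_id H _ => //.
  rewrite /Hn_numerator -natr1.
  by move: ((P k.+1 t * 'X)`_k.+1) ((P k t * 'X)`_k) => x y; ring.
have dD := hankel_derive moment_residuet_derive moment_sqr_pos t0 G0 GS n.
have D0 := det_gt0 moment_sqr_pos n t0.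
have := @is_derive1_comp R (@ln R) (fun s => D n s) t _ _ (is_derive1_ln D0) dD.
by move=> /is_derive_eq; apply; rewrite mulKf// gt_eqF.
Qed.

Lemma Hn_E n t : t < 0 -> Hn n a b g t = Hn_numerator n t.
Proof.
move=> t0; rewrite /Hn derive1E.
have [_ ->] := ln_hankel_derive n t0.
rewrite mulrC divfK// mulf_neq0 ?lt_eqF// subr_lt0.
exact: lt_trans t0 _.
Qed.

(** [E] and [V] are the (1, 1) entries, up to sign, of the residues at 1 and [t];
    [u] and [w] are the two products of opposite off-diagonal entries of these
    residues.  Their difference drives the flow, while their product and sum are
    polynomials in [E] and [V] by singularity of the three residues. *)
Lemma residue_flow N : exists S E V : R -> R, forall t, t < 0 ->
  [/\ S t = E t + t * V t,
      (P N.+1 t * 'X)`_N.+1 = S t,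
      is_derive t 1 S (V t) &
      exists dE u w, [/\ is_derive t 1 E dE, (1 - t) * dE = u - w,
        u * w = E t * (E t - b) * (V t * (V t - g)) &
        u + w = (- N.+1%:R - E t - V t) * (- N.+1%:R - E t - V t - a)
                - E t * (E t - b) - V t * (V t - g)]].
Proof.
pose PN t := P N.+1 t.
exists (fun t => (PN t)`_N), (fun t => mom (ep t) (PN t * q N t)),
  (fun t => mom (nu t) (PN t * q N t)) => t t0.
have D1 := det_neq0 moment_sqr_pos N.+1 t0.
have Pm := orth_poly_monic D1; have Ps := orth_poly_size D1.
have Po := @orth_poly_orth _ (mu t) N.+1.
have qs := dual_poly_size mu N t.
have qd p := @dual_poly_dual _ mu moment_sqr_pos N t p t0.
have Ldef (p : {poly R}) : p != 0 -> mom (mu t) (p * p) != 0.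
  by move=> p0; rewrite gt_eqF// moment_sqr_pos.
have zs k := residue0_shift k t0; have es k := residue1_shift k t0.
have vs k := residuet_shift k t0.
have [dP [dPE sdP dPo]] := orth_poly_derive moment_residuet_derive moment_sqr_pos N.+1 t0.
have [dq [dqE sdq dqo]] := dual_poly_derive moment_residuet_derive moment_sqr_pos N t0.
have [de [deE deL]] := residue1_derive t0.
split.
- exact: (subleading_coef Pm Ps qs Po qd vs zs es (residue_sum t)).
- by rewrite coefMX.
- have [_ _ dN] := dPE.
  apply: is_derive_eq (dN N) _.
  by rewrite -(qd _ sdP) mulrC dPo.
have sch := schlesinger Ldef Pm Ps qs Po qd vs es sdP sdq dPo dqo (mom_lincomb _ deL).
pose p1 := PN t; pose q1 := q N t.
exists (mom de (p1 * q1) + mom (ep t) (dP * q1) + mom (ep t) (p1 * dq)),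
  (mom (ep t) (p1 * p1) * mom (nu t) (q1 * q1)),
  (mom (nu t) (p1 * p1) * mom (ep t) (q1 * q1)).
have rE := rank_one Pm Ps qs Po qd es.
have rV := rank_one Pm Ps qs Po qd vs.
have rZ := rank_one Pm Ps qs Po qd zs.
have sPq := residue_sum_Pq Pm Ps qs Po qd (residue_sum t).
have sPP := residue_sum_PP Pm Ps Po (residue_sum t).
have sqq := residue_sum_qq qs qd (residue_sum t).
split.
- have := is_derive_mom deE (poly_deriveM dPE dqE).
  by move=> /is_derive_eq; apply; rewrite momD addrA.
- exact: sch.
- by rewrite -rE -rV [X in _ * X]mulrC mulrACA [X in _ * X]mulrC.
- have -> : - N.+1%:R - mom (ep t) (p1 * q1) - mom (nu t) (p1 * q1)
      = mom (ze t) (p1 * q1).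
    by rewrite -sPq; exact: cancel_two.
  exact: residue_gram_id sPP sqq rZ rE rV.
Qed.

End JacobiFlow.

(** The sigma form is the square of the Schlesinger equation:
    [(u - w)^2 = (u + w)^2 - 4 u w] expresses the squared second derivative by
    [E] and [V], and [f] and [f'] are affine functions of [E] and [V]. *)
Lemma pvi_id (F : fieldType) (n a b g t E V S dE u w : F) (K := 2 * n + a + b + g)
   (e1 := - (n * (n + a + b + g)) - (a + b) ^+ 2 / 4)
   (e2 := 1 / 4 * (2 * n * (n + a + b + g) + b * (a + b) - g * (a - b)))
   (f := - K * S + n * g * t - n * (n + a + g) + e1 * t + e2)
   (f' := - K * V + n * g + e1) (f'' := K * (dE / t))
   (nu1 := (a + b) / 2) (nu2 := (b - a) / 2) (nu3 := (2 * n + a + b) / 2)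
   (nu4 := (2 * n + a + b + 2 * g) / 2) :
  2 != 0 :> F -> t != 0 -> S = E + t * V -> (1 - t) * dE = u - w ->
  u * w = E * (E - b) * (V * (V - g)) ->
  u + w = (- n - E - V) * (- n - E - V - a) - E * (E - b) - V * (V - g) ->
  f' * (t * (t - 1) * f'') ^+ 2
  + (2 * f' * (t * f' - f) - f' ^+ 2 - nu1 * nu2 * nu3 * nu4) ^+ 2
  = (f' + nu1 ^+ 2) * (f' + nu2 ^+ 2) * (f' + nu3 ^+ 2) * (f' + nu4 ^+ 2).
Proof.
move=> n20 t0 ES EdE Euw Esw.
have -> : (t * (t - 1) * f'') ^+ 2 = K ^+ 2 * ((u + w) ^+ 2 - 4 * (u * w)).
  have -> : t * (t - 1) * f'' = - K * (u - w) by rewrite -EdE /f''; field.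
  ring.
rewrite Euw Esw /nu1 /nu2 /nu3 /nu4 /f' /f /e1 /e2 /K ES.
have n40 : 4 != 0 :> F by rewrite (_ : 4 = 2 * 2) ?mulf_neq0//; ring.
field; by rewrite ?n20 ?n40.
Qed.

Theorem theorem1p1 (R : realType) (n : nat) (alpha beta gamma : R)
    (alpha_gt0 : 0 < alpha) (beta_gt0 : 0 < beta) (n_ge1 : (1 <= n)%N)
    (t : R) (t_lt0 : t < 0) :
  [/\ derivable (fun s : R => ln (hankel_det n alpha beta gamma s)) t 1,
      derivable (tHn n alpha beta gamma) t 1,
      derivable (derive1 (tHn n alpha beta gamma)) t 1
    & Jimbo_Miwa_Okamoto_PVI
        ((alpha + beta) / 2)
        ((beta - alpha) / 2)
        ((2 * n%:R + alpha + beta) / 2)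
        ((2 * n%:R + alpha + beta + 2 * gamma) / 2)
        (tHn n alpha beta gamma) t].
Proof.
case: n n_ge1 => [//|N _]; set n := N.+1.
have [S [E [V flow]]] := residue_flow gamma alpha_gt0 beta_gt0 N.
pose K := 2 * n%:R + alpha + beta + gamma.
pose c1 := d1 n alpha beta gamma.
(* [tHn] is affine in [S], and [S' = V]. *)
have fE (s : R) : s < 0 -> tHn n alpha beta gamma s =
    - K * S s + n%:R * gamma * s - n%:R * (n%:R + alpha + gamma) + c1 * s
    + d2 n alpha beta gamma.
  move=> s0; rewrite /tHn (Hn_E gamma alpha_gt0 beta_gt0)// /Hn_numerator.
  by have [_ -> _ _] := flow s s0.
have f'E (s : R) : s < 0 ->
    is_derive s 1 (tHn n alpha beta gamma) (- K * V s + n%:R * gamma + c1).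
  move=> s0; have [_ _ dS _] := flow s s0.
  have d := is_deriveD (is_deriveD (is_deriveM (is_derive_cst (- K) s 1) dS)
    (is_deriveM (is_derive_cst (n%:R * gamma + c1) s 1) (is_derive_id s 1)))
    (is_derive_cst (d2 n alpha beta gamma - n%:R * (n%:R + alpha + gamma)) s 1).
  apply: near_eq_is_derive (is_derive_eq d _).
    by apply: near_neg s0 => x x0; rewrite fE// !fctE; ring.
  by rewrite /= !scaler0 !addr0 /GRing.scale/= mulr1 addrA.
have f1 (s : R) : s < 0 ->
    derive1 (tHn n alpha beta gamma) s = - K * V s + n%:R * gamma + c1.
  by move=> s0; rewrite derive1E; have [_] := f'E s s0.
have [ES _ dS [dE [u [w [EdE Edw Euw Esw]]]]] := flow t t_lt0.
have t0 : t != 0 by rewrite lt_eqF.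
(* [V = (S - E) / t] near [t], so only the flow of [E] is required. *)
have dV : is_derive t 1 V (- (dE / t)).
  have d := is_deriveM (is_deriveB dS EdE) (is_deriveV t0 (is_derive_id t 1)).
  apply: near_eq_is_derive (is_derive_eq d _).
    apply: near_neg t_lt0 => s s0; have [Ss _ _ _] := flow s s0.
    by rewrite !fctE Ss (addrC (E s)) addrK mulrC mulKf// lt_eqF.
  by rewrite !fctE /GRing.scale/= ES; field.
have f''E : is_derive t 1 (derive1 (tHn n alpha beta gamma)) (K * (dE / t)).
  have d := is_deriveD (is_deriveM (is_derive_cst (- K) t 1) dV)
    (is_derive_cst (n%:R * gamma + c1) t 1).
  apply: near_eq_is_derive (is_derive_eq d _).
    by apply: near_neg t_lt0 => s s0; rewrite f1// !fctE addrA.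
  by rewrite /= scaler0 !addr0 /GRing.scale/= mulrNN.
split.
- by have [] := ln_hankel_derive gamma alpha_gt0 beta_gt0 n t_lt0.
- by have [] := f'E t t_lt0.
- by have [] := f''E.
rewrite /Jimbo_Miwa_Okamoto_PVI f1// fE// derive1E.
have [_ ->] := f''E.
by apply: pvi_id ES Edw Euw Esw.
Qed.
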